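(* Let $f,g:[a;b]\to\mathbb{R}$ be two regulated functions which have no common points of discontinuity. Let $\eta_0\ge\eta_1\ge\ldots$ and $\theta_0\ge\theta_1\ge\ldots$ be two sequences of non-negative numbers such that $\eta_k\downarrow0$ and $\theta_k\downarrow0$ as $k\to+\infty$. Define $\eta_{-1}:=\sup_{a\le t\le b}|f(t)-f(a)|$ and \[ S:=\sum_{k=0}^{+\infty}2^{k}\eta_{k-1}\cdot TV(g,[a;b],\theta_k)+\sum_{k=0}^{+\infty}2^{k}\theta_k\cdot TV(f,[a;b],\eta_k). \] If $S<+\infty$, then the Riemann–Stieltjes integral $\int_a^b f\,\mathrm{d}g$ exists and \[ \left|\int_a^b f\,\mathrm{d}g-f(a)\left[g(b)-g(a)\right]\right|\le S. \]
   Context: A function $h:[a;b]\to\mathbb{R}$ is regulated if the one-sided finite limits $\lim_{t\to a+}h(t)$, $\lim_{t\to b-}h(t)$ exist and, for every $x\in(a;b)$, both finite limits $\lim_{t\to x-}h(t)$ and $\lim_{t\to x+}h(t)$ exist. The total variation is $TV(h,[a;b],0)=\sup_n\sup_{a\le t_1<\dots<t_n\le b}\sum_{i=2}^{n}|h(t_i)-h(t_{i-1})|$. For $\delta\ge0$, the truncated variation is $TV(h,[a;b],\delta):=\inf\{TV(u,[a;b],0):\sup_{a\le t\le b}|h(t)-u(t)|\le\delta/2\}$; for regulated $h$ and $\delta>0$ it equals $\sup_n\sup_{a\le t_1<\dots<t_n\le b}\sum_{i=2}^{n}\max\{|h(t_i)-h(t_{i-1})|-\delta,0\}$. The Riemann–Stieltjes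 integral $\int_a^b f\,\mathrm{d}g$ exists if the sums $\sum_i f(\nu_i)[g(a_i)-g(a_{i-1})]$ over partitions $a=a_0<\dots<a_l=b$ with tags $\nu_i\in[a_{i-1};a_i]$ converge to a common limit as the mesh $\max_i(a_i-a_{i-1})\to0$, independently of the choice of tags. *)

(* Defs.v *)
From Stdlib Require Import Reals.
From Coquelicot Require Import Coquelicot.
Open Scope R_scope.

Definition has_right_limit (h : R -> R) (b x : R) : Prop :=
  exists l : R, forall eps : R, 0 < eps -> exists delta : R, 0 < delta /\
    forall t : R, x < t -> t <= b -> t < x + delta -> Rabs (h t - l) < eps.

Definition has_left_limit (h : R -> R) (a x : R) : Prop :=
  exists l : R, forall eps : R, 0 < eps -> exists delta : R, 0 < delta /\
    forall t : R, a <= t -> t < x -> x - delta < t -> Rabs (h t - l) < eps.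

Definition regulated (h : R -> R) (a b : R) : Prop :=
  (forall x, a <= x < b -> has_right_limit h b x) /\
  (forall x, a < x <= b -> has_left_limit h a x).

Definition continuous_on_at (h : R -> R) (a b x : R) : Prop :=
  forall eps : R, 0 < eps -> exists delta : R, 0 < delta /\
    forall t : R, a <= t <= b -> Rabs (t - x) < delta -> Rabs (h t - h x) < eps.

Definition is_point_seq (a b : R) (t : nat -> R) (n : nat) : Prop :=
  a <= t O /\ t n <= b /\ (forall i, (i < n)%nat -> t i < t (S i)).

Fixpoint var_sum (h : R -> R) (t : nat -> R) (n : nat) : R :=
  match n with
  | O => 0
  | S k => var_sum h t k + Rabs (h (t (S k)) - h (t k))
  end.

Definition TV0 (h : R -> R) (a b : R) : Rbar :=
  Rbar_lub (fun v : Rbar => exists (t : nat -> R) (n : nat),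
              is_point_seq a b t n /\ v = Finite (var_sum h t n)).

Definition TVtrunc (h : R -> R) (a b delta : R) : Rbar :=
  Rbar_glb (fun v : Rbar => exists u : R -> R,
              (forall t, a <= t <= b -> Rabs (h t - u t) <= delta / 2) /\
              v = TV0 u a b).

Definition osc_from_a (h : R -> R) (a b : R) : Rbar :=
  Rbar_lub (fun v : Rbar => exists t, a <= t <= b /\ v = Finite (Rabs (h t - h a))).

Fixpoint Rbar_psum (u : nat -> Rbar) (n : nat) : Rbar :=
  match n with
  | O => u O
  | S k => Rbar_plus (Rbar_psum u k) (u (S k))
  end.

(** Sum of a series of (non-negative) Rbar terms = sup of partial sums. *)
Definition Rbar_series (u : nat -> Rbar) : Rbar := Sup_seq (Rbar_psum u).

Definition eta_prev (f : R -> R) (a b : R) (eta : nat -> R) (k : nat) : Rbar :=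
  match k with
  | O => osc_from_a f a b
  | S j => Finite (eta j)
  end.

(** S = sum_k 2^k eta_{k-1} TV(g,theta_k) + sum_k 2^k theta_k TV(f,eta_k)
    (convention 0 * (+oo) = 0 as in Coquelicot's Rbar_mult). *)
Definition S_bound (f g : R -> R) (a b : R) (eta theta : nat -> R) : Rbar :=
  Rbar_plus
    (Rbar_series (fun k => Rbar_mult (Finite (2 ^ k))
                     (Rbar_mult (eta_prev f a b eta k) (TVtrunc g a b (theta k)))))
    (Rbar_series (fun k => Rbar_mult (Finite (2 ^ k * theta k))
                     (TVtrunc f a b (eta k)))).

Fixpoint RS_sum (f g : R -> R) (p nu : nat -> R) (l : nat) : R :=
  match l with
  | O => 0
  | S k => RS_sum f g p nu k + f (nu (S k)) * (g (p (S k)) - g (p k))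
  end.

Definition is_RS_partition (a b : R) (p : nat -> R) (l : nat) : Prop :=
  p O = a /\ p l = b /\ (forall i, (i < l)%nat -> p i < p (S i)).

Definition is_RS_integral (f g : R -> R) (a b I : R) : Prop :=
  forall eps : R, 0 < eps -> exists delta : R, 0 < delta /\
    forall (p nu : nat -> R) (l : nat),
      is_RS_partition a b p l ->
      (forall i, (i < l)%nat -> p (S i) - p i < delta) ->
      (forall i, (i < l)%nat -> p i <= nu (S i) <= p (S i)) ->
      Rabs (RS_sum f g p nu l - I) < eps.

(* Main.v *)
(** Write D(f,g) for a Riemann-Stieltjes sum of f - f(a) against g. It is bilinear, bounded by
    sup|f - f(a)| TV(g) and, after Abel summation, by sup|g - g(b)| TV(f).

    Bound. Let u_k and v_k be nearly optimal approximations of g and f for the thresholds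
    theta_k and eta_k. Split g = u_0 + (g - u_0), then f = v_0 + (f - v_0), and go on replacing
    alternately u_k by u_{k+1} and v_k by v_{k+1}. A step costs at most
    eta_k TV(u_{k+1} - u_k) <= 2 eta_k TV(g,theta_{k+1}) (up to an arbitrarily small error) or
    the symmetric quantity, and after r steps on a partition with l cells the remainder is at
    most l eta_r theta_r, which tends to 0 for a fixed partition. Starting from f - v_k and
    g - u_k instead gives a tail of S, uniformly in the partition.

    Existence. In D(f,g) = D(v,u) + D(v,g - u) + D(f - v,u) + D(f - v,g - u) with u = u_k,
    v = v_k, the last three terms are small uniformly in the partition. Near every point f or g,
    hence v or u, oscillates little, so D(v,u) is close to the increment of a function Phi glued
    from the local choices v(x) du and d(uv) - u(x) dv. Hence the sums over fine partitions
    concentrate, and the integral exists. If some eta_k or theta_k vanishes, then f or g has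
    bounded variation, and a uniform approximation of the other one replaces u_k or v_k. *)

Require Import Defs.
From Stdlib Require Import Reals Lra Lia Classical.
From Coquelicot Require Import Coquelicot.
Open Scope R_scope.

(** * Induction along a compact interval *)

(** The supremum [c] of the points of [[a; b]] satisfying [Q] satisfies [Q] itself, by a step ending
    at [c]; unless [c = b], a further step starting at [c] passes it. No step across [c] is
    demanded, so one-sided information at [c] can supply the steps. *)
Lemma real_induction (Q : R -> Prop) (a b : R) :
  a <= b -> Q a ->
  (forall c, a <= c <= b -> exists rho, 0 < rho /\
     forall x y, a <= x -> x < y -> y <= b -> c - rho < x -> y < c + rho ->
       y <= c \/ c <= x -> Q x -> Q y) ->
  Q b.
Proof.
intros Hab Qa step.
set (E := fun x => a <= x <= b /\ Q x).
destruct (completeness E) as [c [Hub Hlub]].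
- exists b; intros x [Hx _]; lra.
- exists a; split; [lra | exact Qa].
- assert (Hc : a <= c <= b).
  { split.
    - apply Hub; split; [lra | exact Qa].
    - apply Hlub; intros x [Hx _]; lra. }
  destruct (step c Hc) as [rho [Hrho ext]].
  assert (Qc : Q c).
  { destruct (classic (exists x, E x /\ c - rho < x)) as [[x [[Hx Qx] Hxc]] | no].
    - assert (x <= c) by (apply Hub; split; assumption).
      destruct (Req_dec x c) as [-> | ne]; [exact Qx |].
      apply (ext x c); try assumption; lra.
    - exfalso; assert (c <= c - rho); [| lra].
      apply Hlub; intros x Ex.
      destruct (Rle_dec x (c - rho)) as [h | h]; [exact h |].
      exfalso; apply no; exists x; split; [exact Ex | lra]. }
  destruct (Req_dec c b) as [<- | ne]; [exact Qc | exfalso].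
  pose (y := Rmin b (c + rho / 2)).
  assert (Hy : c < y /\ y <= b /\ y < c + rho).
  { unfold y, Rmin; destruct (Rle_dec b (c + rho / 2)); lra. }
  assert (y <= c); [| lra].
  apply Hub; split; [lra |].
  apply (ext c y); try assumption; try lra.
Qed.

(** * Functions of bounded variation and Riemann-Stieltjes sums *)

(* Bounded variation on [a; b] is encoded by a dominating function [w]; the variation
   of [u] is then at most [w b - w a]. *)
Definition controls (a b : R) (u w : R -> R) : Prop :=
  forall s t, a <= s -> s <= t -> t <= b -> Rabs (u t - u s) <= w t - w s.

Lemma point_seq_snoc (a s s' : R) (u : R -> R) (t : nat -> R) (n : nat) :
  is_point_seq a s t n -> t n < s' ->
  exists t', is_point_seq a s' t' (S n) /\ t' (S n) = s' /\
    var_sum u t' (S n) = var_sum u t n + Rabs (u s' - u (t n)).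
Proof.
intros [H0 [Hn Hi]] Hs.
set (t' := fun i => if Nat.leb i n then t i else s').
assert (low : forall i, (i <= n)%nat -> t' i = t i).
{ intros i Hin; unfold t'; rewrite (proj2 (Nat.leb_le i n) Hin); reflexivity. }
assert (top : t' (S n) = s').
{ unfold t'; rewrite (proj2 (Nat.leb_gt (S n) n)); [reflexivity | lia]. }
assert (var : forall m, (m <= n)%nat -> var_sum u t' m = var_sum u t m).
{ induction m as [| m IH]; intros Hm; [reflexivity |].
  simpl; rewrite IH, !low by lia; reflexivity. }
exists t'; split; [split; [| split] | split].
- rewrite low by lia; exact H0.
- rewrite top; lra.
- intros i Hin; destruct (Nat.eq_dec i n) as [-> | ne].
  + rewrite top, low by lia; exact Hs.
  + rewrite !low by lia; apply Hi; lia.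
- exact top.
- simpl; rewrite var, top, low by lia; reflexivity.
Qed.

(* The control is the variation function x |-> TV(u, [a; x]). *)
Lemma bounded_variation_controls (a b V : R) (u : R -> R) :
  a <= b ->
  (forall t n, is_point_seq a b t n -> var_sum u t n <= V) ->
  exists w, controls a b u w /\ w b - w a <= V.
Proof.
intros Hab HV.
set (E := fun x r => exists t n, is_point_seq a x t n /\ r = var_sum u t n).
assert (zero : forall x, a <= x -> E x 0).
{ intros x Hx; exists (fun _ => a), O; split; [| reflexivity].
  split; [| split]; [lra | lra | intros i Hi; lia]. }
assert (bd : forall x, x <= b -> is_upper_bound (E x) V).
{ intros x Hx r [t [n [[H0 [Hn Hi]] ->]]]; apply HV; split; [| split]; trivial; lra. }
assert (lub : forall x, exists m, a <= x <= b -> is_lub (E x) m).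
{ intros x; destruct (classic (a <= x <= b)) as [Hx | Hx].
  - destruct (completeness (E x)) as [m Hm].
    + exists V; apply bd; lra.
    + exists 0; apply zero; lra.
    + exists m; intros _; exact Hm.
  - exists 0; intros H; contradiction. }
(* [Lub_Rbar] gives the variation as a function of [x] without choosing suprema; on [[a; b]] it is
   finite because of the bound [V]. *)
exists (fun x => real (Lub_Rbar (E x))).
assert (Hw : forall x, a <= x <= b -> is_lub (E x) (real (Lub_Rbar (E x)))).
{ intros x Hx; destruct (lub x) as [m Hm]; specialize (Hm Hx).
  rewrite (is_lub_Rbar_unique (E x) m); [exact Hm |].
  destruct Hm as [H1 H2]; split.
  - intros r Hr; apply H1, Hr.
  - intros [r | |] Hr; simpl; trivial.
    + apply H2; intros y Hy; apply (Hr y Hy).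
    + apply (Hr 0); apply zero; lra. }
split.
- intros s t Has Hst Htb.
  destruct (Hw s) as [_ Ls]; [lra |]; destruct (Hw t) as [Ut _]; [lra |].
  cut (real (Lub_Rbar (E s)) <= real (Lub_Rbar (E t)) - Rabs (u t - u s)); [lra |].
  apply Ls; intros r [q [n [Hq ->]]].
  cut (var_sum u q n + Rabs (u t - u s) <= real (Lub_Rbar (E t))); [lra |].
  destruct Hst as [Hst | <-].
  2:{ rewrite Rminus_diag, Rabs_R0, Rplus_0_r; apply Ut; exists q, n; auto. }
  assert (Hqs : q n <= s) by apply Hq.
  (* Point sequences increase strictly, so [s] is inserted before [t] only if the last point lies
     below [s]. *)
  destruct Hqs as [Hqs | Hqs].
  + destruct (point_seq_snoc a s s u q n Hq Hqs) as [q' [Hq' [E1 E2]]].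
    destruct (point_seq_snoc a s t u q' (S n) Hq') as [q'' [Hq'' [E3 E4]]]; [lra |].
    apply Rle_trans with (var_sum u q'' (S (S n))).
    * rewrite E4, E2, E1; generalize (Rabs_pos (u s - u (q n))); lra.
    * apply Ut; exists q'', (S (S n)); auto.
  + destruct (point_seq_snoc a s t u q n Hq) as [q' [Hq' [E1 E2]]]; [lra |].
    rewrite Hqs in E2; rewrite <- E2; apply Ut; exists q', (S n); auto.
- destruct (Hw a) as [Ua _]; [lra |]; destruct (Hw b) as [_ Lb]; [lra |].
  assert (0 <= real (Lub_Rbar (E a))) by (apply Ua, zero; lra).
  assert (real (Lub_Rbar (E b)) <= V) by (apply Lb, bd; lra).
  lra.
Qed.

Lemma controls_mono (a b : R) (u w : R -> R) (s t : R) :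
  controls a b u w -> a <= s -> s <= t -> t <= b -> w s <= w t.
Proof.
intros H Has Hst Htb; generalize (H s t Has Hst Htb) (Rabs_pos (u t - u s)); lra.
Qed.

Lemma controls_minus (a b : R) (u v wu wv : R -> R) :
  controls a b u wu -> controls a b v wv ->
  controls a b (fun t => u t - v t) (fun t => wu t + wv t).
Proof.
intros Hu Hv s t Has Hst Htb.
generalize (Hu s t Has Hst Htb) (Hv s t Has Hst Htb).
unfold Rabs; repeat destruct Rcase_abs; lra.
Qed.

Definition tagged_partition (a b : R) (p nu : nat -> R) (l : nat) : Prop :=
  is_RS_partition a b p l /\
  forall i, (i < l)%nat -> p i <= nu (S i) <= p (S i).

Lemma partition_range (a b : R) (p : nat -> R) (l : nat) :
  is_RS_partition a b p l -> forall i, (i <= l)%nat -> a <= p i <= b.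
Proof.
intros [H0 [Hl Hi]] i Hil; split.
- rewrite <- H0; clear Hl; induction i as [| i IH]; [lra |].
  apply Rle_trans with (p i); [apply IH; lia | left; apply Hi; lia].
(* The upper bound goes by induction downwards from the last point. *)
- rewrite <- Hl; assert (H : forall k, (k <= l)%nat -> p (l - k)%nat <= p l).
  { induction k as [| k IH]; intros Hk; [rewrite Nat.sub_0_r; lra |].
    apply Rle_trans with (p (l - k)%nat); [| apply IH; lia].
    replace (l - k)%nat with (S (l - S k)) by lia; left; apply Hi; lia. }
  replace i with (l - (l - i))%nat by lia; apply H; lia.
Qed.

(** This is $D(f,g)$. Recentring at [f a] makes it insensitive to constants added to [f] or [g], so
    bounds on oscillations suffice. *)
Definition RS_dev (a : R) (f g : R -> R) (p nu : nat -> R) (l : nat) : R :=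
  RS_sum (fun t => f t - f a) g p nu l.

Lemma RS_sum_telescope (a b : R) (f g : R -> R) (p nu : nat -> R) (l : nat) :
  is_RS_partition a b p l ->
  RS_sum f g p nu l = RS_dev a f g p nu l + f a * (g b - g a).
Proof.
intros [H0 [Hl _]].
replace (g b - g a) with (g (p l) - g (p O)) by (rewrite Hl, H0; ring).
clear Hl; unfold RS_dev; induction l as [| l IH]; simpl; [ring |].
rewrite IH; ring.
Qed.

Lemma RS_dev_plus_l (a : R) (f f1 f2 g : R -> R) (p nu : nat -> R) (l : nat) :
  (forall t, f t = f1 t + f2 t) ->
  RS_dev a f g p nu l = RS_dev a f1 g p nu l + RS_dev a f2 g p nu l.
Proof.
intros E; unfold RS_dev; induction l as [| l IH]; simpl; [ring | rewrite IH, !E; ring].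
Qed.

Lemma RS_dev_plus_r (a : R) (f g g1 g2 : R -> R) (p nu : nat -> R) (l : nat) :
  (forall t, g t = g1 t + g2 t) ->
  RS_dev a f g p nu l = RS_dev a f g1 p nu l + RS_dev a f g2 p nu l.
Proof.
intros E; unfold RS_dev; induction l as [| l IH]; simpl; [ring | rewrite IH, !E; ring].
Qed.

(** A cell costs at most [M] times the increment of [w] over it, and these increments telescope. *)
Lemma RS_dev_bound_r (a b M : R) (f g w : R -> R) (p nu : nat -> R) (l : nat) :
  tagged_partition a b p nu l ->
  (forall t, a <= t <= b -> Rabs (f t - f a) <= M) -> controls a b g w ->
  Rabs (RS_dev a f g p nu l) <= M * (w b - w a).
Proof.
intros [Hp Hnu] HM Hw.
assert (H : forall k, (k <= l)%nat -> Rabs (RS_dev a f g p nu k) <= M * (w (p k) - w (p O))).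
{ induction k as [| k IH]; intros Hk; unfold RS_dev; simpl.
  - rewrite Rabs_R0; right; ring.
  - pose proof (partition_range a b p l Hp k ltac:(lia)).
    pose proof (partition_range a b p l Hp (S k) ltac:(lia)).
    pose proof (Hnu k ltac:(lia)).
    eapply Rle_trans; [apply Rabs_triang |].
    replace (M * (w (p (S k)) - w (p O))) with
      (M * (w (p k) - w (p O)) + M * (w (p (S k)) - w (p k))) by ring.
    apply Rplus_le_compat; [apply IH; lia |].
    rewrite Rabs_mult; apply Rmult_le_compat; try apply Rabs_pos.
    + apply HM; lra.
    + apply Hw; lra. }
pose proof (H l (le_n l)) as Hl.
destruct Hp as [H0 [H1 _]]; rewrite H0, H1 in Hl; exact Hl.
Qed.

(* Abel summation: the increments are moved from [g] to [f]. *)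
Lemma RS_dev_bound_l (a b M : R) (f g w : R -> R) (p nu : nat -> R) (l : nat) :
  tagged_partition a b p nu l -> a <= b ->
  (forall t, a <= t <= b -> Rabs (g t - g b) <= M) -> controls a b f w ->
  Rabs (RS_dev a f g p nu l) <= M * (w b - w a).
Proof.
intros [Hp Hnu] Hab HM Hw.
(* The boundary term of the summation by parts is carried along with a free endpoint [x], so that
   the induction hypothesis applies at the next tag. It vanishes for [k = l], where [p l = b]. *)
assert (H : forall k, (k <= l)%nat -> forall x, p k <= x <= b ->
  Rabs (RS_dev a f g p nu k - (f x - f a) * (g (p k) - g b)) <= M * (w x - w a)).
{ induction k as [| k IH]; intros Hk x Hx; unfold RS_dev; simpl.
  - destruct Hp as [H0 _]; rewrite H0 in Hx |- *.
    rewrite Rminus_0_l, Rabs_Ropp, Rabs_mult, Rmult_comm.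
    apply Rmult_le_compat; try apply Rabs_pos; [apply HM | apply Hw]; lra.
  - pose proof (partition_range a b p l Hp k ltac:(lia)).
    pose proof (partition_range a b p l Hp (S k) ltac:(lia)).
    pose proof (Hnu k ltac:(lia)) as Hk'.
    fold (RS_dev a f g p nu k).
    replace (RS_dev a f g p nu k + (f (nu (S k)) - f a) * (g (p (S k)) - g (p k))
             - (f x - f a) * (g (p (S k)) - g b)) with
      ((RS_dev a f g p nu k - (f (nu (S k)) - f a) * (g (p k) - g b))
       - (f x - f (nu (S k))) * (g (p (S k)) - g b)) by ring.
    replace (M * (w x - w a)) with
      (M * (w (nu (S k)) - w a) + M * (w x - w (nu (S k)))) by ring.
    eapply Rle_trans; [apply Rabs_triang |]; rewrite Rabs_Ropp.
    apply Rplus_le_compat; [apply IH; [lia | lra] |].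
    rewrite Rabs_mult, (Rmult_comm M).
    apply Rmult_le_compat; try apply Rabs_pos; [apply Hw | apply HM]; lra. }
assert (Hb := Hp); destruct Hb as [_ [Hb _]].
pose proof (H l (le_n l) b ltac:(lra)) as Hl; rewrite Hb in Hl.
replace (RS_dev a f g p nu l - (f b - f a) * (g b - g b)) with (RS_dev a f g p nu l) in Hl by ring.
exact Hl.
Qed.

(** No variation enters, at the price of the factor [l]. This serves for remainders on a fixed
    partition and for sums in which [M] or [N] is 0. *)
Lemma RS_dev_crude (a b M N : R) (f g : R -> R) (p nu : nat -> R) (l : nat) :
  tagged_partition a b p nu l ->
  (forall t, a <= t <= b -> Rabs (f t - f a) <= M) ->
  (forall s t, a <= s <= b -> a <= t <= b -> Rabs (g t - g s) <= N) ->
  Rabs (RS_dev a f g p nu l) <= INR l * (M * N).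
Proof.
intros [Hp Hnu] HM HN.
assert (H : forall k, (k <= l)%nat -> Rabs (RS_dev a f g p nu k) <= INR k * (M * N)).
{ induction k as [| k IH]; intros Hk.
  - unfold RS_dev; simpl; rewrite Rabs_R0; lra.
  - pose proof (partition_range a b p l Hp k ltac:(lia)).
    pose proof (partition_range a b p l Hp (S k) ltac:(lia)).
    pose proof (Hnu k ltac:(lia)).
    rewrite S_INR, Rmult_plus_distr_r, Rmult_1_l.
    unfold RS_dev; simpl; eapply Rle_trans; [apply Rabs_triang |].
    apply Rplus_le_compat; [apply IH; lia |].
    rewrite Rabs_mult; apply Rmult_le_compat; try apply Rabs_pos; [apply HM | apply HN]; lra. }
apply H, le_n.
Qed.

(** * Local potentials *)

Definition osc_le (u : R -> R) (a b al : R) : Prop :=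
  forall s t, a <= s <= b -> a <= t <= b -> Rabs (u t - u s) <= al.

Lemma osc_le_sub (u : R -> R) (a b a' b' al : R) :
  osc_le u a b al -> a <= a' -> b' <= b -> osc_le u a' b' al.
Proof. intros H Ha Hb s t Hs Ht; apply H; lra. Qed.

Lemma Rabs_mult_le (x y c d : R) : Rabs x <= c -> Rabs y <= d -> Rabs (x * y) <= c * d.
Proof. intros; rewrite Rabs_mult; apply Rmult_le_compat; auto using Rabs_pos. Qed.

Lemma controls_sub (a b a' b' : R) (u w : R -> R) :
  controls a b u w -> a <= a' -> b' <= b -> controls a' b' u w.
Proof. intros H Ha Hb s t Hs Hst Ht; apply H; lra. Qed.

Section Potential.

Variables (u v wu wv : R -> R) (al be : R).
Hypotheses (al0 : 0 <= al) (be0 : 0 <= be).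

(** Its increments measure the price of freezing: [al] times the variation of [u] where [v] is
    frozen, [be] times that of [v] where [u] is. *)
Let W (t : R) : R := al * wu t + be * wv t.

(** For a fixed tag this is additive over adjacent cells, which is what allows cells to be split. *)
Definition cell_error (Phi : R -> R) (y z tag : R) : R :=
  v tag * (u z - u y) - (Phi z - Phi y).

(** The factor that oscillates little is bounded by its oscillation, the other one by its
    variation. *)
Lemma osc_cross (y z q r s t : R) :
  controls y z u wu -> controls y z v wv ->
  osc_le v y z al \/ osc_le u y z be ->
  y <= q -> q <= r -> r <= z -> y <= s -> s <= t -> t <= z ->
  Rabs ((v r - v q) * (u t - u s)) <= W z - W y.
Proof.
intros Hu Hv H Hyq Hqr Hrz Hys Hst Htz.
pose proof (controls_mono y z u wu y s Hu). pose proof (controls_mono y z u wu t z Hu).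
pose proof (controls_mono y z v wv y q Hv). pose proof (controls_mono y z v wv r z Hv).
assert (0 <= wu z - wu y).
{ generalize (controls_mono y z u wu y z Hu); lra. }
assert (0 <= wv z - wv y).
{ generalize (controls_mono y z v wv y z Hv); lra. }
unfold W; destruct H as [H | H].
- apply Rle_trans with (al * (wu t - wu s)).
  + apply Rabs_mult_le; [apply H | apply Hu]; lra.
  + assert (al * (wu t - wu s) <= al * (wu z - wu y)) by (apply Rmult_le_compat_l; lra).
    assert (0 <= be * (wv z - wv y)) by (apply Rmult_le_pos; lra). lra.
- rewrite Rmult_comm; apply Rle_trans with (be * (wv r - wv q)).
  + apply Rabs_mult_le; [apply H | apply Hv]; lra.
  + assert (be * (wv r - wv q) <= be * (wv z - wv y)) by (apply Rmult_le_compat_l; lra).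
    assert (0 <= al * (wu z - wu y)) by (apply Rmult_le_pos; lra). lra.
Qed.

(* Freeze [v] at the left end if [v] oscillates little; otherwise freeze [u] in
   [d(u v) - u dv]. *)
Lemma local_potential (x y : R) :
  x <= y -> controls x y u wu -> controls x y v wv ->
  osc_le v x y al \/ osc_le u x y be ->
  exists Phi, forall s t, x <= s -> s <= t -> t <= y ->
    Rabs (cell_error Phi s t s) <= W t - W s /\ Rabs (cell_error Phi s t t) <= W t - W s.
Proof.
intros Hxy Hu Hv H.
destruct H as [H | H].
- exists (fun t => v x * u t); unfold cell_error, W; intros s t Hxs Hst Hty.
  assert (0 <= be * (wv t - wv s)).
  { apply Rmult_le_pos; [lra |]; generalize (controls_mono x y v wv s t Hv); lra. }
  assert (forall q, x <= q <= y ->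
    Rabs (v q * (u t - u s) - (v x * u t - v x * u s)) <= al * (wu t - wu s)).
  { intros q Hq.
    replace (v q * (u t - u s) - (v x * u t - v x * u s)) with ((v q - v x) * (u t - u s)) by ring.
    apply Rabs_mult_le; [apply H | apply Hu]; lra. }
  split; (eapply Rle_trans; [apply H1; lra | lra]).
- exists (fun t => u t * v t - u x * v t); unfold cell_error, W; intros s t Hxs Hst Hty.
  assert (0 <= al * (wu t - wu s)).
  { apply Rmult_le_pos; [lra |]; generalize (controls_mono x y u wu s t Hu); lra. }
  assert (forall q, x <= q <= y ->
    Rabs ((u q - u x) * (v t - v s)) <= be * (wv t - wv s)).
  { intros q Hq; apply Rabs_mult_le; [apply H | apply Hv]; lra. }
  split.
  + replace (v s * (u t - u s) - (u t * v t - u x * v t - (u s * v s - u x * v s)))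
      with (- ((u t - u x) * (v t - v s))) by ring.
    rewrite Rabs_Ropp; eapply Rle_trans; [apply H1; lra | lra].
  + replace (v t * (u t - u s) - (u t * v t - u x * v t - (u s * v s - u x * v s)))
      with (- ((u s - u x) * (v t - v s))) by ring.
    rewrite Rabs_Ropp; eapply Rle_trans; [apply H1; lra | lra].
Qed.

(* The sharper bound on the cells ending at [x] leaves room for the cross term of
   the cells that straddle [x] once [Phi] is prolonged. *)
Definition is_potential (a x : R) (Phi : R -> R) (d : R) : Prop :=
  forall s t, a <= s -> s <= t -> t <= x -> t - s < d ->
    (Rabs (cell_error Phi s t s) <= 2 * (W t - W s) /\
     Rabs (cell_error Phi s t t) <= 2 * (W t - W s)) /\
    (t = x -> Rabs (cell_error Phi s t s) <= W t - W s /\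
              Rabs (cell_error Phi s t t) <= W t - W s).

(** [Phi] is continued past [x] by the increments of a local potential. Since [lo < x], the
    oscillation bound has a margin to the left of [x], which contains the short cells that straddle
    [x]. *)
Lemma potential_extend (a x y lo : R) (Phi : R -> R) (d : R) :
  a <= x -> x < y -> lo < x -> 0 < d ->
  controls a y u wu -> controls a y v wv ->
  (osc_le v (Rmax a lo) y al \/ osc_le u (Rmax a lo) y be) ->
  is_potential a x Phi d ->
  exists Phi' d', 0 < d' /\ is_potential a y Phi' d'.
Proof.
intros Hax Hxy Hlo Hd Hu Hv Hosc HPhi.
assert (Rmax a lo <= x) by (apply Rmax_lub; lra).
destruct (local_potential x y) as [La HL]; try lra.
{ apply (controls_sub a y); trivial; lra. }
{ apply (controls_sub a y); trivial; lra. }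
{ destruct Hosc as [h | h]; [left | right]; apply (osc_le_sub _ _ _ _ _ _ h); lra. }
set (Psi := fun t => if Rle_dec t x then Phi t else Phi x + (La t - La x)).
assert (PsiL : forall t, t <= x -> Psi t = Phi t).
{ intros t Ht; unfold Psi; destruct (Rle_dec t x); [reflexivity | contradiction]. }
assert (PsiR : forall t, x <= t -> Psi t = Phi x + (La t - La x)).
{ intros t Ht; unfold Psi; destruct (Rle_dec t x); [| reflexivity].
  replace t with x by lra; ring. }
(* [d] keeps the old bounds, [x - lo] keeps straddling cells to the right of [lo], and [y - x]
   forces a cell ending at [y] to start after [x], as the sharp clause at [y] requires. *)
set (d' := Rmin d (Rmin (x - lo) (y - x))).
assert (Hd' : 0 < d' /\ d' <= d /\ d' <= x - lo /\ d' <= y - x).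
{ unfold d', Rmin; repeat destruct Rle_dec; lra. }
assert (Wm : forall s t, a <= s -> s <= t -> t <= y -> 0 <= W t - W s).
{ intros s t Has Hst Hty.
  pose proof (controls_mono a y u wu s t Hu Has Hst Hty).
  pose proof (controls_mono a y v wv s t Hv Has Hst Hty).
  assert (0 <= al * (wu t - wu s)) by (apply Rmult_le_pos; lra).
  assert (0 <= be * (wv t - wv s)) by (apply Rmult_le_pos; lra).
  unfold W; lra. }
assert (right_cell : forall s t, x <= s -> s <= t -> t <= y ->
  Rabs (cell_error Psi s t s) <= W t - W s /\ Rabs (cell_error Psi s t t) <= W t - W s).
{ intros s t Hs Hst Ht; unfold cell_error; rewrite !PsiR by lra.
  replace (Phi x + (La t - La x) - (Phi x + (La s - La x))) with (La t - La s) by ring.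
  apply HL; assumption. }
assert (left_cell : forall s t q, s <= x -> t <= x -> cell_error Psi s t q = cell_error Phi s t q).
{ intros s t q Hs Ht; unfold cell_error; rewrite !PsiL by lra; reflexivity. }
exists Psi, d'; split; [lra |].
intros s t Has Hst Hty Hts; split.
- destruct (Rle_dec x s) as [Hxs | Hxs].
  { generalize (right_cell s t Hxs Hst Hty) (Wm s t Has Hst Hty); lra. }
  destruct (Rle_dec t x) as [Htx | Htx].
  { rewrite !left_cell by lra; apply HPhi; lra. }
  (* The cell straddles [x] and is split there. The sharp clause of [HPhi] and [right_cell] together
     cost one increment of [W]; moving a tag across [x] leaves a cross term, which costs the second
     one. *)
  destruct (HPhi s x) as [_ [P1 P2]]; try lra.
  destruct (right_cell x t) as [Q1 Q2]; try lra.
  rewrite <- left_cell in P1, P2 by lra.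
  assert (Rmax a lo <= s) by (apply Rmax_lub; lra).
  assert (Hosc' : osc_le v s t al \/ osc_le u s t be).
  { destruct Hosc as [h | h]; [left | right]; apply (osc_le_sub _ _ _ _ _ _ h); lra. }
  assert (Hu' : controls s t u wu) by (apply (controls_sub a y); trivial; lra).
  assert (Hv' : controls s t v wv) by (apply (controls_sub a y); trivial; lra).
  pose proof (osc_cross s t s x x t Hu' Hv' Hosc') as C1.
  pose proof (osc_cross s t x t s x Hu' Hv' Hosc') as C2.
  split.
  + replace (cell_error Psi s t s) with
      (cell_error Psi s x s + (cell_error Psi x t x - (v x - v s) * (u t - u x)))
      by (unfold cell_error; ring).
    eapply Rle_trans; [apply Rabs_triang |].
    generalize (Rabs_triang (cell_error Psi x t x) (- ((v x - v s) * (u t - u x)))).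
    rewrite Rabs_Ropp; unfold Rminus in *; lra.
  + replace (cell_error Psi s t t) with
      (cell_error Psi s x x + (cell_error Psi x t t + (v t - v x) * (u x - u s)))
      by (unfold cell_error; ring).
    eapply Rle_trans; [apply Rabs_triang |].
    generalize (Rabs_triang (cell_error Psi x t t) ((v t - v x) * (u x - u s))).
    lra.
- intros ->; apply right_cell; lra.
Qed.

Lemma potential_exists (a b : R) :
  a <= b -> controls a b u wu -> controls a b v wv ->
  (forall c, a <= c <= b -> exists rho, 0 < rho /\
     forall s t, a <= s -> t <= b -> c - rho < s -> t < c + rho ->
       osc_le v s t al \/ osc_le u s t be) ->
  exists Phi d, 0 < d /\ is_potential a b Phi d.
Proof.
intros Hab Hu Hv Hloc.
apply (real_induction (fun x => exists Phi d, 0 < d /\ is_potential a x Phi d) a b Hab).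
- exists (fun _ => 0), 1; split; [lra |].
  intros s t Has Hst Hta _; replace t with a by lra; replace s with a by lra.
  unfold cell_error; rewrite !Rminus_diag, !Rmult_0_r, Rminus_diag, Rabs_R0; lra.
- intros c Hc; destruct (Hloc c Hc) as [rho [Hrho Hosc]].
  exists rho; split; [exact Hrho |].
  intros x y Hax Hxy Hyb Hxc Hyc _ [Phi [d [Hd HPhi]]].
  (* The midpoint of [c - rho] and [x] leaves a margin on both sides: below [x], yet inside the
     neighbourhood of [c]. *)
  apply (potential_extend a x y ((x + (c - rho)) / 2) Phi d); trivial; try lra.
  + apply (controls_sub a b); trivial; lra.
  + apply (controls_sub a b); trivial; lra.
  + apply Hosc; try lra; [apply Rmax_l |].
    apply Rlt_le_trans with ((x + (c - rho)) / 2); [lra | apply Rmax_r].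
Qed.

(** Each cell is split at its tag into two cells tagged at an endpoint, the only kind that a
    potential controls. *)
Lemma RS_sum_potential (a b : R) (Phi : R -> R) (d : R) (p nu : nat -> R) (l : nat) :
  is_potential a b Phi d -> tagged_partition a b p nu l ->
  (forall i, (i < l)%nat -> p (S i) - p i < d) ->
  Rabs (RS_sum v u p nu l - (Phi b - Phi a)) <= 2 * (W b - W a).
Proof.
intros HPhi [Hp Hnu] Hmesh.
assert (H : forall k, (k <= l)%nat ->
  Rabs (RS_sum v u p nu k - (Phi (p k) - Phi (p O))) <= 2 * (W (p k) - W (p O))).
{ induction k as [| k IH]; intros Hk; simpl.
  - rewrite !Rminus_diag, Rabs_R0; lra.
  - pose proof (partition_range a b p l Hp k ltac:(lia)).
    pose proof (partition_range a b p l Hp (S k) ltac:(lia)).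
    pose proof (Hnu k ltac:(lia)). pose proof (Hmesh k ltac:(lia)).
    specialize (IH ltac:(lia)).
    set (q := nu (S k)) in *.
    destruct (HPhi (p k) q) as [[_ E1] _]; try lra.
    destruct (HPhi q (p (S k))) as [[E2 _] _]; try lra.
    replace (RS_sum v u p nu k + v q * (u (p (S k)) - u (p k)) - (Phi (p (S k)) - Phi (p O)))
      with (RS_sum v u p nu k - (Phi (p k) - Phi (p O)) +
            (cell_error Phi (p k) q q + cell_error Phi q (p (S k)) q))
      by (unfold cell_error; ring).
    eapply Rle_trans; [apply Rabs_triang |].
    generalize (Rabs_triang (cell_error Phi (p k) q q) (cell_error Phi q (p (S k)) q)); lra. }
specialize (H l (le_n l)); destruct Hp as [H0 [Hl _]]; rewrite H0, Hl in H; exact H.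
Qed.

End Potential.

(** * Existence of the integral *)

Definition near (a b : R) (f v : R -> R) (al : R) : Prop :=
  forall t, a <= t <= b -> Rabs (f t - v t) <= al.

Lemma near_osc (a b al s t : R) (f v : R -> R) :
  near a b f v al -> a <= s <= b -> a <= t <= b ->
  Rabs ((f t - v t) - (f s - v s)) <= 2 * al.
Proof.
intros H Hs Ht; generalize (H s Hs) (H t Ht).
unfold Rabs; repeat destruct Rcase_abs; lra.
Qed.

(** Passing from [v] to [f] at both points costs [2 * al], comparing both values with [f c] costs
    [2 * tol]. *)
Lemma near_osc_le (a b al tol c rho : R) (f v : R -> R) :
  near a b f v al ->
  (forall t, a <= t <= b -> Rabs (t - c) < rho -> Rabs (f t - f c) < tol) ->
  forall x y, a <= x -> y <= b -> c - rho < x -> y < c + rho ->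
    osc_le v x y (2 * al + 2 * tol).
Proof.
intros H Hf x y Hx Hy Hxc Hyc s t Hs Ht.
assert (Hs' : Rabs (s - c) < rho) by (apply Rabs_def1; lra).
assert (Ht' : Rabs (t - c) < rho) by (apply Rabs_def1; lra).
generalize (Hf s ltac:(lra) Hs') (Hf t ltac:(lra) Ht') (H s ltac:(lra)) (H t ltac:(lra)).
unfold Rabs; repeat destruct Rcase_abs; lra.
Qed.

(** The two products control $D(f-v,u)$ and $D(v,g-u)$; the last clause controls $D(f-v,g-u)$
    uniformly in the partition. *)
Definition BV_approx (a b : R) (f g : R -> R) (eps : R) : Prop :=
  exists u v wu wv al be,
    near a b f v al /\ near a b g u be /\
    controls a b u wu /\ controls a b v wv /\
    al * (wu b - wu a) <= eps /\ be * (wv b - wv a) <= eps /\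
    forall p nu l, tagged_partition a b p nu l ->
      Rabs (RS_dev a (fun t => f t - v t) (fun t => g t - u t) p nu l) <= eps.

Lemma RS_sum_concentrated (a b : R) (f g : R -> R) (eps : R) :
  a <= b -> 0 < eps ->
  (forall x, a <= x <= b -> continuous_on_at f a b x \/ continuous_on_at g a b x) ->
  BV_approx a b f g eps ->
  exists C d, 0 < d /\ forall p nu l, tagged_partition a b p nu l ->
    (forall i, (i < l)%nat -> p (S i) - p i < d) ->
    Rabs (RS_sum f g p nu l - C) <= 17 * eps.
Proof.
intros Hab He Hcont [u [v [wu [wv [al [be [Hf [Hg [Hu [Hv [Eu [Ev Htail]]]]]]]]]]]].
assert (al0 : 0 <= al).
{ apply Rle_trans with (2 := Hf a ltac:(lra)), Rabs_pos. }
assert (be0 : 0 <= be).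
{ apply Rle_trans with (2 := Hg a ltac:(lra)), Rabs_pos. }
set (Vu := wu b - wu a) in *; set (Vv := wv b - wv a) in *.
assert (Vu0 : 0 <= Vu).
{ generalize (controls_mono a b u wu a b Hu); unfold Vu; lra. }
assert (Vv0 : 0 <= Vv).
{ generalize (controls_mono a b v wv a b Hv); unfold Vv; lra. }
(* Chosen so that [tol * (Vu + Vv) <= eps]; the summand 1 keeps the divisor positive. *)
set (tol := eps / (Vu + Vv + 1)).
assert (Htol : 0 < tol) by (apply Rdiv_lt_0_compat; lra).
assert (Etol : tol * (Vu + Vv + 1) = eps) by (unfold tol; field; lra).
destruct (potential_exists u v wu wv (2 * al + 2 * tol) (2 * be + 2 * tol)
            ltac:(lra) ltac:(lra) a b Hab Hu Hv) as [Phi [d [Hd HPhi]]].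
{ intros c Hc; destruct (Hcont c Hc) as [H | H];
    destruct (H tol Htol) as [rho [Hrho Hr]]; exists rho; split; trivial.
  - intros s t Hs Ht Hsc Htc; left; apply (near_osc_le a b al tol c rho f v Hf Hr); assumption.
  - intros s t Hs Ht Hsc Htc; right; apply (near_osc_le a b be tol c rho g u Hg Hr); assumption. }
(* The increment of [Phi] approximates the sum of [v] against [u]; the two corrections pass to
   $D(v,u)$ and from $D(f,g)$ back to the sum of [f] against [g]. *)
exists (Phi b - Phi a - v a * (u b - u a) + f a * (g b - g a)), d; split; [exact Hd |].
intros p nu l HP Hmesh.
pose proof (RS_sum_potential u v wu wv _ _ a b Phi d p nu l HPhi HP Hmesh) as B0.
pose proof (Htail p nu l HP) as B1.
assert (B2 : Rabs (RS_dev a (fun t => f t - v t) u p nu l) <= 2 * al * Vu).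
{ apply RS_dev_bound_r; trivial; intros t Ht; apply (near_osc a b); trivial; lra. }
assert (B3 : Rabs (RS_dev a v (fun t => g t - u t) p nu l) <= 2 * be * Vv).
{ apply RS_dev_bound_l; trivial; intros t Ht; apply (near_osc a b); trivial; lra. }
rewrite (RS_sum_telescope a b v u) in B0 by apply HP.
rewrite (RS_sum_telescope a b f g) by apply HP.
rewrite (RS_dev_plus_l a f v (fun t => f t - v t) g) by (intros; ring).
rewrite (RS_dev_plus_r a v g u (fun t => g t - u t)) by (intros; ring).
rewrite (RS_dev_plus_r a (fun t => f t - v t) g u (fun t => g t - u t)) by (intros; ring).
replace (2 * ((2 * al + 2 * tol) * wu b + (2 * be + 2 * tol) * wv b -
         ((2 * al + 2 * tol) * wu a + (2 * be + 2 * tol) * wv a))) with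
  (4 * (al * Vu) + 4 * (be * Vv) + 4 * (tol * (Vu + Vv))) in B0 by (unfold Vu, Vv; ring).
(* The constant is 17 = 12 + 1 + 2 + 2, from [B0] to [B3] in order. *)
revert B0 B1 B2 B3; unfold Rabs; repeat destruct Rcase_abs; lra.
Qed.

(** * Uniform partitions and the limit of the sums *)

(** There are [n + 1] cells, so the step makes sense for every [n]. The same sequence also serves as
    tags, namely the right ends of the cells. *)
Definition uniform_point (a b : R) (n i : nat) : R := a + INR i * ((b - a) / INR (S n)).

Lemma uniform_partition (a b : R) (n : nat) :
  a < b -> tagged_partition a b (uniform_point a b n) (uniform_point a b n) (S n).
Proof.
intros Hab.
assert (Hn : 0 < INR (S n)) by (apply lt_0_INR; lia).
assert (Hs : 0 < (b - a) / INR (S n)) by (apply Rdiv_lt_0_compat; lra).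
assert (step : forall i, uniform_point a b n (S i) = uniform_point a b n i + (b - a) / INR (S n)).
{ intros i; unfold uniform_point; rewrite (S_INR i); ring. }
split; [split; [| split] |].
- unfold uniform_point; simpl INR; ring.
- unfold uniform_point; field; lra.
- intros i _; rewrite step; lra.
- intros i _; rewrite step; lra.
Qed.

Lemma uniform_mesh (a b d : R) :
  a < b -> 0 < d -> exists N, forall n, (N <= n)%nat ->
    forall i, uniform_point a b n (S i) - uniform_point a b n i < d.
Proof.
intros Hab Hd.
destruct (INR_unbounded ((b - a) / d)) as [N HN].
exists N; intros n Hn i; unfold uniform_point; rewrite (S_INR i).
assert (Hn' : INR N <= INR n) by (apply le_INR; exact Hn).
assert (0 < INR (S n)) by (apply lt_0_INR; lia).
replace (a + (INR i + 1) * ((b - a) / INR (S n)) - (a + INR i * ((b - a) / INR (S n))))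
  with ((b - a) / INR (S n)) by (field; lra).
apply Rmult_lt_reg_r with (INR (S n)); trivial.
replace ((b - a) / INR (S n) * INR (S n)) with (b - a) by (field; lra).
replace (b - a) with ((b - a) / d * d) by (field; lra).
rewrite (Rmult_comm d); apply Rmult_lt_compat_r; trivial; rewrite S_INR; lra.
Qed.

(** By concentration the sums over uniform partitions form a Cauchy sequence. Any other fine
    partition is compared with its limit through the common centre [C]. *)
Lemma RS_integral_exists (a b : R) (f g : R -> R) :
  a < b ->
  (forall x, a <= x <= b -> continuous_on_at f a b x \/ continuous_on_at g a b x) ->
  (forall eps, 0 < eps -> BV_approx a b f g eps) ->
  exists I, is_RS_integral f g a b I.
Proof.
intros Hab Hcont Happ.
assert (conc : forall eps, 0 < eps -> exists C d, 0 < d /\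
  forall p nu l, tagged_partition a b p nu l ->
    (forall i, (i < l)%nat -> p (S i) - p i < d) -> Rabs (RS_sum f g p nu l - C) <= eps).
{ intros eps He; replace eps with (17 * (eps / 17)) by field.
  apply RS_sum_concentrated; trivial; [lra | lra | apply Happ; lra]. }
set (s := fun n => RS_sum f g (uniform_point a b n) (uniform_point a b n) (S n)).
assert (Cs : Cauchy_crit s).
{ intros eps He; destruct (conc (eps / 3) ltac:(lra)) as [C [d [Hd HC]]].
  destruct (uniform_mesh a b d Hab Hd) as [N HN].
  exists N; intros n m Hn Hm; unfold Rdist.
  pose proof (HC _ _ _ (uniform_partition a b n Hab) (fun i _ => HN n Hn i)) as Bn.
  pose proof (HC _ _ _ (uniform_partition a b m Hab) (fun i _ => HN m Hm i)) as Bm.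
  fold (s n) in Bn; fold (s m) in Bm.
  revert Bn Bm; unfold Rabs; repeat destruct Rcase_abs; lra. }
destruct (Rcomplete.R_complete s Cs) as [I HI]; exists I.
intros eps He; destruct (conc (eps / 4) ltac:(lra)) as [C [d [Hd HC]]].
exists d; split; [exact Hd |]; intros p nu l Hp Hmesh Hnu.
destruct (uniform_mesh a b d Hab Hd) as [N HN].
destruct (HI (eps / 4) ltac:(lra)) as [N' HN'].
set (n := Nat.max N N').
pose proof (HN' n ltac:(lia)) as B1; unfold Rdist in B1.
pose proof (HC _ _ _ (uniform_partition a b n Hab) (fun i _ => HN n ltac:(lia) i)) as B2.
pose proof (HC p nu l (conj Hp Hnu) Hmesh) as B3.
fold (s n) in B2.
revert B1 B2 B3; unfold Rabs; repeat destruct Rcase_abs; lra.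
Qed.

Lemma RS_integral_bound (a b I B : R) (f g : R -> R) :
  a < b -> is_RS_integral f g a b I ->
  (forall p nu l, tagged_partition a b p nu l -> Rabs (RS_dev a f g p nu l) <= B) ->
  Rabs (I - f a * (g b - g a)) <= B.
Proof.
intros Hab HI HB; apply le_epsilon; intros eps He.
destruct (HI eps He) as [d [Hd H]].
destruct (uniform_mesh a b d Hab Hd) as [N HN].
pose proof (uniform_partition a b N Hab) as HP.
pose proof (H _ _ _ (proj1 HP) (fun i _ => HN N (le_n N) i) (proj2 HP)) as B1.
pose proof (HB _ _ _ HP) as B2.
rewrite (RS_sum_telescope a b f g) in B1 by apply HP.
revert B1 B2; unfold Rabs; repeat destruct Rcase_abs; lra.
Qed.

(** * Uniform approximation of regulated functions *)

(** The approximation is continued by the constant [l] on the open interval and by [h y] at [y]; the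
    control grows by the two jumps [M] and [M']. *)
Lemma regulated_extend (a x y l eps : R) (h : R -> R) :
  a <= x -> x < y -> 0 <= eps ->
  (forall t, x < t < y -> Rabs (h t - l) <= eps) ->
  (exists u w, near a x h u eps /\ controls a x u w) ->
  exists u w, near a y h u eps /\ controls a y u w.
Proof.
intros Hax Hxy He Hl [u [w [Hn Hc]]].
set (M := Rabs (l - u x)); set (M' := Rabs (h y - l)).
exists (fun t => if Rle_dec t x then u t else if Rlt_dec t y then l else h y),
  (fun t => if Rle_dec t x then w t else if Rlt_dec t y then w x + M else w x + M + M').
split.
- intros t Ht; destruct (Rle_dec t x); [apply Hn; lra |].
  destruct (Rlt_dec t y); [apply Hl; lra |].
  replace t with y by lra; rewrite Rminus_diag, Rabs_R0; exact He.
- assert (HM : Rabs (l - u x) = M) by reflexivity.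
  assert (HM' : Rabs (h y - l) = M') by reflexivity.
  clearbody M M'.
  intros s t Has Hst Hty.
  destruct (Rle_dec s x); destruct (Rle_dec t x); try lra.
  + apply Hc; lra.
  + pose proof (Hc s x ltac:(lra) ltac:(lra) ltac:(lra)) as B.
    destruct (Rlt_dec t y); revert B HM HM'; unfold Rabs; repeat destruct Rcase_abs; lra.
  + destruct (Rlt_dec s y); destruct (Rlt_dec t y); try lra;
      rewrite ?Rminus_diag, ?Rabs_R0; lra.
Qed.

(** Real induction builds a step function, the constants being one-sided limits of [h] at the points
    [c]. *)
Lemma regulated_BV_approx (a b eps : R) (h : R -> R) :
  a <= b -> 0 < eps -> regulated h a b ->
  exists u w, near a b h u eps /\ controls a b u w.
Proof.
intros Hab He [Hr Hlft].
apply (real_induction (fun x => exists u w, near a x h u eps /\ controls a x u w) a b Hab).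
- exists h, (fun _ => 0); split.
  + intros t _; rewrite Rminus_diag, Rabs_R0; lra.
  + intros s t Hs Hst Ht; replace t with a by lra; replace s with a by lra.
    rewrite !Rminus_diag, Rabs_R0; lra.
- intros c Hc.
  assert (R : exists rho, 0 < rho /\ forall x y, c <= x -> x < y -> y <= b -> y < c + rho ->
     exists l, forall t, x < t < y -> Rabs (h t - l) <= eps).
  { destruct (Req_dec c b) as [-> | ne].
    - exists 1; split; [lra | intros; lra].
    - destruct (Hr c ltac:(lra)) as [l Hl]; destruct (Hl eps He) as [d [Hd H]].
      exists d; split; trivial; intros x y H1 H2 H3 H4; exists l; intros t Ht.
      left; apply H; lra. }
  assert (L : exists rho, 0 < rho /\ forall x y, a <= x -> x < y -> y <= c -> c - rho < x ->
     exists l, forall t, x < t < y -> Rabs (h t - l) <= eps).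
  { destruct (Req_dec c a) as [-> | ne].
    - exists 1; split; [lra | intros; lra].
    - destruct (Hlft c ltac:(lra)) as [l Hl]; destruct (Hl eps He) as [d [Hd H]].
      exists d; split; trivial; intros x y H1 H2 H3 H4; exists l; intros t Ht.
      left; apply H; lra. }
  destruct R as [r1 [Hr1 R]]; destruct L as [r2 [Hr2 L]].
  exists (Rmin r1 r2); split; [apply Rmin_pos; trivial |].
  generalize (Rmin_l r1 r2) (Rmin_r r1 r2); intros m1 m2.
  intros x y Hax Hxy Hyb Hxc Hyc [Hc' | Hc'] HQ.
  + destruct (L x y) as [l Hl]; try lra; apply (regulated_extend a x y l); trivial; lra.
  + destruct (R x y) as [l Hl]; try lra; apply (regulated_extend a x y l); trivial; lra.
Qed.

Lemma regulated_bounded (a b : R) (h : R -> R) :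
  a <= b -> regulated h a b ->
  exists M, forall t, a <= t <= b -> Rabs (h t - h a) <= M.
Proof.
intros Hab Hreg; destruct (regulated_BV_approx a b 1 h Hab Rlt_0_1 Hreg) as [u [w [Hn Hc]]].
exists (w b - w a + 2); intros t Ht.
generalize (Hn t Ht) (Hn a ltac:(lra)) (Hc a t ltac:(lra) ltac:(lra) ltac:(lra))
  (controls_mono a b u w t b Hc ltac:(lra) ltac:(lra) ltac:(lra)).
unfold Rabs; repeat destruct Rcase_abs; lra.
Qed.

(** * The telescoping estimate *)

(** A competitor in the infimum defining $TV(g,[a;b],th)$, of variation at most [V]. The half makes
    [g - u] oscillate by at most [th]. *)
Definition BV_near (a b : R) (g u : R -> R) (th V : R) : Prop :=
  near a b g u (th / 2) /\ exists w, controls a b u w /\ w b - w a <= V.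

(** Used to let the slack [ka] of nearly optimal approximations tend to 0. *)
Lemma le_of_small_perturbation (x y z : R) :
  (forall ka, 0 < ka -> x <= y + ka * z) -> x <= y.
Proof.
intros H; apply le_epsilon; intros eps He.
assert (0 < 1 + Rabs z) by (generalize (Rabs_pos z); lra).
eapply Rle_trans; [apply (H (eps / (1 + Rabs z))); apply Rdiv_lt_0_compat; lra |].
apply Rplus_le_compat_l.
apply Rle_trans with (eps / (1 + Rabs z) * (1 + Rabs z)).
- apply Rmult_le_compat_l; [left; apply Rdiv_lt_0_compat; lra | generalize (Rle_abs z); lra].
- right; field; lra.
Qed.

Lemma near_osc_half (a b th s t : R) (f v : R -> R) :
  near a b f v (th / 2) -> a <= s <= b -> a <= t <= b ->
  Rabs ((f t - v t) - (f s - v s)) <= th.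
Proof.
intros H Hs Ht; replace th with (2 * (th / 2)) by field; apply (near_osc a b); assumption.
Qed.

Lemma RS_dev_near_crude (a b et th : R) (f v g u : R -> R) (p nu : nat -> R) (l : nat) :
  tagged_partition a b p nu l -> a <= b -> near a b f v (et / 2) -> near a b g u (th / 2) ->
  Rabs (RS_dev a (fun t => f t - v t) (fun t => g t - u t) p nu l) <= INR l * (et * th).
Proof.
intros HP Hab Hf Hg; apply (RS_dev_crude a b); trivial; intros.
- apply (near_osc_half a b); trivial; lra.
- apply (near_osc_half a b); trivial.
Qed.

(* One half-step of the telescoping: replacing the approximation [u] by [u'] costs
   the total variation of [u' - u]. *)
Lemma RS_dev_refine_r (a b et V V' th th' : R) (f v g u u' : R -> R) (p nu : nat -> R) (l : nat) :
  tagged_partition a b p nu l -> 0 <= et -> a <= b -> near a b f v (et / 2) ->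
  BV_near a b g u th V -> BV_near a b g u' th' V' ->
  Rabs (RS_dev a (fun t => f t - v t) (fun t => g t - u t) p nu l) <=
  et * (V' + V) + Rabs (RS_dev a (fun t => f t - v t) (fun t => g t - u' t) p nu l).
Proof.
intros HP He Hab Hf [_ [w [Hw HV]]] [_ [w' [Hw' HV']]].
rewrite (RS_dev_plus_r a _ (fun t => g t - u t) (fun t => u' t - u t) (fun t => g t - u' t))
  by (intros; ring).
eapply Rle_trans; [apply Rabs_triang | apply Rplus_le_compat_r].
eapply Rle_trans.
- apply (RS_dev_bound_r a b et _ _ (fun t => w' t + w t)); trivial.
  + intros t Ht; apply (near_osc_half a b); trivial; lra.
  + apply controls_minus; assumption.
- apply Rmult_le_compat_l; lra.
Qed.

Lemma RS_dev_refine_l (a b th V V' et et' : R) (g u f v v' : R -> R) (p nu : nat -> R) (l : nat) :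
  tagged_partition a b p nu l -> 0 <= th -> a <= b -> near a b g u (th / 2) ->
  BV_near a b f v et V -> BV_near a b f v' et' V' ->
  Rabs (RS_dev a (fun t => f t - v t) (fun t => g t - u t) p nu l) <=
  th * (V' + V) + Rabs (RS_dev a (fun t => f t - v' t) (fun t => g t - u t) p nu l).
Proof.
intros HP He Hab Hg [_ [w [Hw HV]]] [_ [w' [Hw' HV']]].
rewrite (RS_dev_plus_l a (fun t => f t - v t) (fun t => v' t - v t) (fun t => f t - v' t))
  by (intros; ring).
eapply Rle_trans; [apply Rabs_triang | apply Rplus_le_compat_r].
eapply Rle_trans.
- apply (RS_dev_bound_l a b th _ _ (fun t => w' t + w t)); trivial.
  + intros t Ht; apply (near_osc_half a b); trivial; lra.
  + apply controls_minus; assumption.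
- apply Rmult_le_compat_l; lra.
Qed.

Section Chain.

(** [T k] and [U k] stand for $TV(g,\theta_k)$ and $TV(f,\eta_k)$ as real numbers, [c k] for the
    terms of index [k] of both series together. Monotonicity and approximations are assumed only
    where the coefficient of the variation is positive: by the convention $0\cdot\infty=0$, a finite
    [S] says nothing about the others. *)
Variables (a b : R) (f g : R -> R) (eta theta T U c : nat -> R).
Hypothesis Hab : a <= b.
Hypotheses (eta0 : forall k, 0 <= eta k) (theta0 : forall k, 0 <= theta k).
Hypotheses (T0 : forall k, 0 <= T k) (U0 : forall k, 0 <= U k).
Hypothesis Tmono : forall k, 0 < eta k -> T k <= T (S k).
Hypothesis Umono : forall k, 0 < theta (S k) -> U k <= U (S k).
Hypothesis Tapp : forall k, 0 < eta k -> forall ka, 0 < ka ->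
  exists u, BV_near a b g u (theta (S k)) (T (S k) + ka).
Hypothesis Uapp : forall k, 0 < theta k -> forall ka, 0 < ka ->
  exists v, BV_near a b f v (eta k) (U k + ka).
Hypothesis Hc : forall k, 2 * (eta k * T (S k)) + 2 * (theta (S k) * U (S k)) <= c (S k).

Lemma chain_cost_nonneg (k : nat) : 0 <= c (S k).
Proof.
generalize (Hc k) (Rmult_le_pos _ _ (eta0 k) (T0 (S k)))
  (Rmult_le_pos _ _ (theta0 (S k)) (U0 (S k))); lra.
Qed.

Lemma chain_cost_mono (k m : nat) : sum_f_R0 c k <= sum_f_R0 c (k + m).
Proof.
induction m as [| m IH]; [rewrite Nat.add_0_r; lra |].
rewrite Nat.add_succ_r; simpl; generalize (chain_cost_nonneg (k + m)); lra.
Qed.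

(** Induction on the number [m] of refinements, from any starting pair. Replacing [u], then [v],
    costs [c (S k)] up to slack, since each change involves two variations, both at most the finer
    one up to slack. *)
Lemma chain_bound (m k : nat) (ka : R) (u v : R -> R) (p nu : nat -> R) (l : nat) :
  0 <= ka -> tagged_partition a b p nu l ->
  BV_near a b g u (theta k) (T k + ka) -> BV_near a b f v (eta k) (U k + ka) ->
  Rabs (RS_dev a (fun t => f t - v t) (fun t => g t - u t) p nu l) <=
  (sum_f_R0 c (k + m) - sum_f_R0 c k) + ka * (eta k + theta (S k))
  + INR l * (eta (k + m)%nat * theta (k + m)%nat).
Proof.
intros Hka HP; revert k ka u v Hka; induction m as [| m IH]; intros k ka u v Hka Hu Hv.
- pose proof (RS_dev_near_crude a b _ _ f v g u p nu l HP Hab (proj1 Hv) (proj1 Hu)).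
  rewrite Nat.add_0_r.
  assert (0 <= ka * (eta k + theta (S k))).
  { apply Rmult_le_pos; trivial; generalize (eta0 k) (theta0 (S k)); lra. }
  lra.
- assert (Hpos : 0 <= (sum_f_R0 c (k + S m) - sum_f_R0 c k) + ka * (eta k + theta (S k))
    + INR l * (eta (k + S m)%nat * theta (k + S m)%nat)).
  { generalize (chain_cost_mono k (S m)).
    assert (0 <= ka * (eta k + theta (S k))).
    { apply Rmult_le_pos; trivial; generalize (eta0 k) (theta0 (S k)); lra. }
    assert (0 <= INR l * (eta (k + S m)%nat * theta (k + S m)%nat)).
    { apply Rmult_le_pos; [apply pos_INR | apply Rmult_le_pos; auto]. }
    lra. }
  (* If [eta k = 0], then [f = v] on [[a; b]] and the sum vanishes. *)
  destruct (eta0 k) as [ek | ek].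
  2:{ eapply Rle_trans; [| exact Hpos].
      eapply Rle_trans; [apply (RS_dev_near_crude a b (eta k) (theta k)) |];
        trivial; [apply Hv | apply Hu | rewrite <- ek; right; ring]. }
  (* The new slack [ka'] enters with weight [eta k + theta (S k)] in the two replacements and with
     the remaining weight in the induction hypothesis. *)
  apply (le_of_small_perturbation _ _ (eta k + theta (S k) + (eta (S k) + theta (S (S k))))).
  intros ka' Hka'; destruct (Tapp k ek ka' Hka') as [u' Hu'].
  pose proof (RS_dev_refine_r a b (eta k) _ _ _ _ f v g u u' p nu l HP
                (eta0 k) Hab (proj1 Hv) Hu Hu') as B1.
  assert (Kn : 0 <= ka' * (eta k + theta (S k) + (eta (S k) + theta (S (S k))))).
  { apply Rmult_le_pos; [lra |].
    generalize (theta0 (S k)) (eta0 (S k)) (theta0 (S (S k))); lra. }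
  assert (ET : eta k * (T (S k) + ka' + (T k + ka)) <=
               2 * (eta k * T (S k)) + (ka' + ka) * eta k).
  { replace (2 * (eta k * T (S k)) + (ka' + ka) * eta k) with
      (eta k * (T (S k) + ka' + (T (S k) + ka))) by ring.
    apply Rmult_le_compat_l; [lra | generalize (Tmono k ek); lra]. }
  (* If [theta (S k) = 0], then [g = u'] on [[a; b]] and the chain stops after its first
     half-step. *)
  destruct (theta0 (S k)) as [tk | tk].
  2:{ pose proof (RS_dev_near_crude a b _ _ f v g u' p nu l HP Hab (proj1 Hv) (proj1 Hu')) as B2.
      rewrite <- tk, !Rmult_0_r in B2.
      generalize (Hc k) (chain_cost_mono (S k) m).
      replace (k + S m)%nat with (S k + m)%nat in * by lia.
      rewrite <- tk in Hpos |- *; simpl sum_f_R0 at 1.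
      assert (0 <= INR l * (eta (S k + m)%nat * theta (S k + m)%nat)).
      { apply Rmult_le_pos; [apply pos_INR | apply Rmult_le_pos; auto]. }
      assert (0 <= ka' * (eta (S k) + theta (S (S k)))).
      { apply Rmult_le_pos; [lra |]; generalize (eta0 (S k)) (theta0 (S (S k))); lra. }
      lra. }
  destruct (Uapp (S k) tk ka' Hka') as [v' Hv'].
  pose proof (RS_dev_refine_l a b (theta (S k)) _ _ _ _ g u' f v v' p nu l HP
                (theta0 (S k)) Hab (proj1 Hu') Hv Hv') as B2.
  assert (EU : theta (S k) * (U (S k) + ka' + (U k + ka)) <=
               2 * (theta (S k) * U (S k)) + (ka' + ka) * theta (S k)).
  { replace (2 * (theta (S k) * U (S k)) + (ka' + ka) * theta (S k)) with
      (theta (S k) * (U (S k) + ka' + (U (S k) + ka))) by ring.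
    apply Rmult_le_compat_l; [lra | generalize (Umono k tk); lra]. }
  pose proof (IH (S k) ka' u' v' ltac:(lra) Hu' Hv') as B3.
  replace (k + S m)%nat with (S k + m)%nat in * by lia.
  pose proof (Hc k).
  assert (Es : sum_f_R0 c (S k) = sum_f_R0 c k + c (S k)) by reflexivity.
  rewrite Es in B3; lra.
Qed.

Hypotheses (eta_lim : is_lim_seq eta 0) (theta_lim : is_lim_seq theta 0).

(** The partition is fixed while [m] tends to infinity, so the remainder with its factor [l]
    disappears and the bound is uniform in the partition. *)
Lemma chain_bound_lim (L ka : R) (k : nat) (u v : R -> R) (p nu : nat -> R) (l : nat) :
  (forall n, sum_f_R0 c n <= L) ->
  0 <= ka -> tagged_partition a b p nu l ->
  BV_near a b g u (theta k) (T k + ka) -> BV_near a b f v (eta k) (U k + ka) ->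
  Rabs (RS_dev a (fun t => f t - v t) (fun t => g t - u t) p nu l) <=
  (L - sum_f_R0 c k) + ka * (eta k + theta (S k)).
Proof.
intros HL Hka HP Hu Hv.
set (x := Rabs _).
apply (is_lim_seq_le (fun _ => x)
  (fun m => (L - sum_f_R0 c k) + ka * (eta k + theta (S k))
            + INR l * (eta (m + k)%nat * theta (m + k)%nat)) x
  ((L - sum_f_R0 c k) + ka * (eta k + theta (S k)))).
- intros m; generalize (chain_bound m k ka u v p nu l Hka HP Hu Hv) (HL (k + m)%nat).
  fold x; rewrite (Nat.add_comm k m); lra.
- apply is_lim_seq_const.
- replace (Finite (L - sum_f_R0 c k + ka * (eta k + theta (S k)))) with
    (Finite (L - sum_f_R0 c k + ka * (eta k + theta (S k)) + 0)) by (f_equal; ring).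
  apply is_lim_seq_plus'; [apply is_lim_seq_const |].
  replace (Finite 0) with (Finite (INR l * (0 * 0))) by (f_equal; ring).
  apply is_lim_seq_mult'; [apply is_lim_seq_const |].
  apply is_lim_seq_mult'.
  + apply (is_lim_seq_incr_n eta); assumption.
  + apply (is_lim_seq_incr_n theta); assumption.
Qed.

(** [M] is $\eta_{-1}$. At index 0 nothing has been replaced yet, so only one variation is paid each
    time and [Hc0] carries no factor 2. *)
Variables (M N : R).
Hypothesis M0 : 0 <= M.
Hypothesis HM : forall t, a <= t <= b -> Rabs (f t - f a) <= M.
Hypothesis HN : forall s t, a <= s <= b -> a <= t <= b -> Rabs (g t - g s) <= N.
Hypothesis Tapp0 : 0 < M -> forall ka, 0 < ka ->
  exists u, BV_near a b g u (theta O) (T O + ka).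
Hypothesis Hc0 : M * T O + theta O * U O <= c O.

(** In $D(f,g)=D(f,u_0)+D(v_0,g-u_0)+D(f-v_0,g-u_0)$ the first two terms cost [c 0] up to slack, and
    the chain bounds the last one by the remaining costs. *)
Lemma chain_total (L : R) (p nu : nat -> R) (l : nat) :
  (forall n, sum_f_R0 c n <= L) -> tagged_partition a b p nu l ->
  Rabs (RS_dev a f g p nu l) <= L.
Proof.
intros HL HP.
pose proof (HL O) as HL0; simpl in HL0.
pose proof (Rmult_le_pos _ _ M0 (T0 O)). pose proof (Rmult_le_pos _ _ (theta0 O) (U0 O)).
destruct M0 as [Mp | Mz].
2:{ generalize (RS_dev_crude a b M N f g p nu l HP HM HN).
    rewrite <- Mz, Rmult_0_l, Rmult_0_r; lra. }
apply (le_of_small_perturbation _ _ (M + theta O + (eta O + theta (S O)))).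
intros ka Hka; destruct (Tapp0 Mp ka Hka) as [u Hu].
assert (Kn : 0 <= ka * (eta O + theta (S O))).
{ apply Rmult_le_pos; [lra | generalize (eta0 O) (theta0 (S O)); lra]. }
rewrite (RS_dev_plus_r a f g u (fun t => g t - u t)) by (intros; ring).
eapply Rle_trans; [apply Rabs_triang |].
assert (B1 : Rabs (RS_dev a f u p nu l) <= M * (T O + ka)).
{ destruct Hu as [_ [w [Hw HV]]].
  eapply Rle_trans; [apply (RS_dev_bound_r a b M f u w); trivial |].
  apply Rmult_le_compat_l; lra. }
destruct (theta0 O) as [tk | tk].
2:{ assert (B2 : Rabs (RS_dev a f (fun t => g t - u t) p nu l) <= INR l * (M * theta O)).
    { apply (RS_dev_crude a b); trivial.
      intros s t Hs Ht; apply (near_osc_half a b); trivial; apply Hu. }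
    rewrite <- tk, !Rmult_0_r in B2; rewrite <- tk; lra. }
destruct (Uapp O tk ka Hka) as [v Hv].
rewrite (RS_dev_plus_l a f v (fun t => f t - v t) (fun t => g t - u t)) by (intros; ring).
assert (B2 : Rabs (RS_dev a v (fun t => g t - u t) p nu l) <= theta O * (U O + ka)).
{ destruct Hv as [_ [w [Hw HV]]].
  eapply Rle_trans; [apply (RS_dev_bound_l a b (theta O) v _ w); trivial |].
  - intros t Ht; apply (near_osc_half a b); trivial; [apply Hu | lra].
  - apply Rmult_le_compat_l; lra. }
pose proof (chain_bound_lim L ka O u v p nu l HL (Rlt_le _ _ Hka) HP Hu Hv) as B3.
simpl sum_f_R0 in B3.
generalize (Rabs_triang (RS_dev a v (fun t => g t - u t) p nu l)
  (RS_dev a (fun t => f t - v t) (fun t => g t - u t) p nu l)); lra.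
Qed.

(** * Vanishing thresholds and the approximations for existence *)

Lemma near_zero_controls (h u : R -> R) (V : R) :
  BV_near a b h u 0 V -> exists w, controls a b h w.
Proof.
intros [Hn [w [Hw _]]]; exists w.
assert (E : forall t, a <= t <= b -> h t = u t).
{ intros t Ht; generalize (Hn t Ht); unfold Rabs; destruct Rcase_abs; lra. }
intros s t Hs Hst Ht; rewrite !E by lra; apply Hw; assumption.
Qed.

(** If neither function has bounded variation, then [M > 0], as [f] is not constant. Each positive
    coefficient then provides an approximation whose threshold cannot vanish, giving positivity of
    $\theta_0,\eta_0,\theta_1,\eta_1,\ldots$ in this order. *)
Lemma chain_dichotomy :
  (forall k, 0 < eta k /\ 0 < theta k) \/
  (exists w, controls a b f w) \/ (exists w, controls a b g w).
Proof.
destruct (classic ((exists w, controls a b f w) \/ (exists w, controls a b g w)))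
  as [H | H]; [right; exact H | left].
assert (Mp : 0 < M).
{ destruct M0 as [Mp | Mz]; [exact Mp | exfalso; apply H; left; exists (fun _ => 0)].
  intros s t Hs Hst Ht; generalize (HM s ltac:(lra)) (HM t ltac:(lra)); rewrite <- Mz.
  unfold Rabs; repeat destruct Rcase_abs; lra. }
assert (eta_pos : forall k, 0 < theta k -> 0 < eta k).
{ intros k tk; destruct (eta0 k) as [ek | ek]; [exact ek | exfalso; apply H; left].
  destruct (Uapp k tk 1 Rlt_0_1) as [v Hv]; rewrite <- ek in Hv.
  exact (near_zero_controls _ _ _ Hv). }
assert (theta_pos : forall k, 0 < theta k).
{ induction k as [| k IH].
  - destruct (theta0 O) as [tk | tk]; [exact tk | exfalso; apply H; right].
    destruct (Tapp0 Mp 1 Rlt_0_1) as [u Hu]; rewrite <- tk in Hu.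
    exact (near_zero_controls _ _ _ Hu).
  - destruct (theta0 (S k)) as [tk | tk]; [exact tk | exfalso; apply H; right].
    destruct (Tapp k (eta_pos k IH) 1 Rlt_0_1) as [u Hu]; rewrite <- tk in Hu.
    exact (near_zero_controls _ _ _ Hu). }
auto.
Qed.

Lemma BV_approx_chain (L eps : R) :
  (forall k, 0 < eta k /\ 0 < theta k) ->
  (forall k, eta (S k) <= eta k) -> (forall k, theta (S k) <= theta k) ->
  (forall n, sum_f_R0 c n <= L) -> 0 < eps -> BV_approx a b f g eps.
Proof.
intros Hpos eta_dec theta_dec HL He.
assert (Ag : Un_growing (sum_f_R0 c)).
{ intros n; simpl; generalize (chain_cost_nonneg n); lra. }
(* Tails are measured against the actual sum [L'], since those against the bound [L] need not tend
   to 0. *)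
destruct (Un_cv_crit (sum_f_R0 c) Ag) as [L' HL'].
{ exists L; intros x [n ->]; apply HL. }
pose proof (growing_ineq _ _ Ag HL') as HLn.
destruct (HL' (eps / 4) ltac:(lra)) as [n1 H1].
apply is_lim_seq_Reals in eta_lim as Le; apply is_lim_seq_Reals in theta_lim as Lt.
destruct (Le (eps / 4) ltac:(lra)) as [n2 H2]; destruct (Lt (eps / 4) ltac:(lra)) as [n3 H3].
set (j := (n1 + n2 + n3)%nat).
specialize (H1 j ltac:(lia)); specialize (H2 j ltac:(lia)); specialize (H3 j ltac:(lia)).
unfold Rdist in H1, H2, H3; apply Rabs_def2 in H1, H2, H3.
(* A slack of 1 is harmless: it is always multiplied by thresholds below [eps / 4]. *)
destruct (Tapp j (proj1 (Hpos j)) 1 Rlt_0_1) as [u Hu].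
destruct (Uapp (S j) (proj2 (Hpos (S j))) 1 Rlt_0_1) as [v Hv].
pose proof (Hc j) as Hcj; pose proof (HLn (S j)) as HS; simpl in HS.
pose proof (eta_dec j) as ej; pose proof (theta_dec j) as tj.
pose proof (theta_dec (S j)) as tj'.
pose proof (Rmult_le_pos _ _ (theta0 (S j)) (U0 (S j))).
pose proof (Rmult_le_pos _ _ (eta0 j) (T0 (S j))).
assert (Ed : eta (S j) * T (S j) <= eta j * T (S j)) by (apply Rmult_le_compat_r; auto).
pose proof Hu as [Nu [wu [Cu Vu]]]; pose proof Hv as [Nv [wv [Cv Vv]]].
exists u, v, wu, wv, (eta (S j) / 2), (theta (S j) / 2).
repeat apply conj; trivial.
- apply Rle_trans with (eta (S j) / 2 * (T (S j) + 1)).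
  + apply Rmult_le_compat_l; [generalize (eta0 (S j)) |]; lra.
  + lra.
- apply Rle_trans with (theta (S j) / 2 * (U (S j) + 1)).
  + apply Rmult_le_compat_l; [generalize (theta0 (S j)) |]; lra.
  + lra.
- intros p nu l HP.
  eapply Rle_trans; [apply (chain_bound_lim L' 1 (S j) u v p nu l HLn); trivial; lra |].
  simpl sum_f_R0; generalize (chain_cost_nonneg j); lra.
Qed.

End Chain.

Lemma near_refl (a b : R) (f : R -> R) : near a b f f 0.
Proof. intros t _; rewrite Rminus_diag, Rabs_R0; lra. Qed.

(** With [v = f] and [al = 0] the remainder vanishes, and it suffices that [be] times the variation
    of [f] is small. *)
Lemma BV_approx_of_controls_l (a b eps : R) (f g w : R -> R) :
  a <= b -> 0 < eps -> regulated g a b -> controls a b f w -> BV_approx a b f g eps.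
Proof.
intros Hab He Hg Hw.
assert (V0 : 0 <= w b - w a) by (generalize (controls_mono a b f w a b Hw); lra).
set (be := eps / (w b - w a + 1)).
assert (Hbe : 0 < be) by (apply Rdiv_lt_0_compat; lra).
assert (Ebe : be * (w b - w a + 1) = eps) by (unfold be; field; lra).
destruct (regulated_BV_approx a b be g Hab Hbe Hg) as [u [wu [Nu Cu]]].
exists u, f, wu, w, 0, be; repeat apply conj; trivial; [apply near_refl | lra | lra |].
intros p nu l HP.
eapply Rle_trans; [apply (RS_dev_near_crude a b 0 (2 * be)); trivial |].
- replace (0 / 2) with 0 by field; apply near_refl.
- replace (2 * be / 2) with be by field; exact Nu.
- rewrite Rmult_0_l, Rmult_0_r; lra.
Qed.

Lemma BV_approx_of_controls_r (a b eps : R) (f g w : R -> R) :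
  a <= b -> 0 < eps -> regulated f a b -> controls a b g w -> BV_approx a b f g eps.
Proof.
intros Hab He Hf Hw.
assert (V0 : 0 <= w b - w a) by (generalize (controls_mono a b g w a b Hw); lra).
set (al := eps / (w b - w a + 1)).
assert (Hal : 0 < al) by (apply Rdiv_lt_0_compat; lra).
assert (Eal : al * (w b - w a + 1) = eps) by (unfold al; field; lra).
destruct (regulated_BV_approx a b al f Hab Hal Hf) as [v [wv [Nv Cv]]].
exists g, v, w, wv, al, 0; repeat apply conj; trivial; [apply near_refl | lra | lra |].
intros p nu l HP.
eapply Rle_trans; [apply (RS_dev_near_crude a b (2 * al) 0); trivial |].
- replace (2 * al / 2) with al by field; exact Nv.
- replace (0 / 2) with 0 by field; apply near_refl.
- rewrite !Rmult_0_r; lra.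
Qed.

(** * Truncated variation and series in [Rbar] *)

Lemma Rbar_lub_correct (E : Rbar -> Prop) : Rbar_is_lub E (Rbar_lub E).
Proof. exact (proj2_sig (Rbar_ex_lub E)). Qed.

Lemma Rbar_glb_correct (E : Rbar -> Prop) : Rbar_is_glb E (Rbar_glb E).
Proof. exact (proj2_sig (Rbar_ex_glb E)). Qed.

Lemma TV0_nonneg (h : R -> R) (a b : R) : a <= b -> Rbar_le 0 (TV0 h a b).
Proof.
intros Hab; apply (proj1 (Rbar_lub_correct _)); exists (fun _ => a), O; split; [| reflexivity].
split; [| split]; [lra | lra | intros i Hi; lia].
Qed.

Lemma TVtrunc_nonneg (h : R -> R) (a b d : R) : a <= b -> Rbar_le 0 (TVtrunc h a b d).
Proof.
intros Hab; apply (proj2 (Rbar_glb_correct _)); intros x [u [_ ->]]; apply TV0_nonneg, Hab.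
Qed.

Lemma TVtrunc_antitone (h : R -> R) (a b d d' : R) :
  d <= d' -> Rbar_le (TVtrunc h a b d') (TVtrunc h a b d).
Proof.
intros Hd; apply Rbar_glb_subset; intros x [u [Hu ->]]; exists u; split; [| reflexivity].
intros t Ht; generalize (Hu t Ht); lra.
Qed.

(** Without a competitor of variation at most [T + ka], this number would be a lower bound exceeding
    the infimum. *)
Lemma TVtrunc_approx (h : R -> R) (a b d T ka : R) :
  a <= b -> TVtrunc h a b d = Finite T -> 0 < ka -> exists u, BV_near a b h u d (T + ka).
Proof.
intros Hab HT Hka.
destruct (classic (exists u, near a b h u (d / 2) /\ Rbar_le (TV0 u a b) (T + ka)))
  as [[u [Hu HV]] | no].
- exists u; split; [exact Hu |]; apply bounded_variation_controls; [exact Hab |].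
  intros t n Ht; change (Rbar_le (var_sum u t n) (T + ka)).
  apply Rbar_le_trans with (2 := HV).
  apply (proj1 (Rbar_lub_correct _)); exists t, n; auto.
- exfalso; assert (H : Rbar_le (T + ka) T); [| simpl in H; lra].
  rewrite <- HT; apply (proj2 (Rbar_glb_correct _)); intros x [u [Hu ->]].
  destruct (Rbar_le_lt_dec (TV0 u a b) (T + ka)) as [H | H]; [| apply Rbar_lt_le, H].
  exfalso; apply no; exists u; split; assumption.
Qed.

Lemma osc_from_a_finite (f : R -> R) (a b B : R) :
  a <= b -> (forall t, a <= t <= b -> Rabs (f t - f a) <= B) ->
  exists M, osc_from_a f a b = Finite M /\ 0 <= M /\
    forall t, a <= t <= b -> Rabs (f t - f a) <= M.
Proof.
intros Hab HB; unfold osc_from_a.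
match goal with |- context [Rbar_lub ?E] =>
  destruct (Rbar_lub_correct E) as [Hu Hl]; set (l := Rbar_lub E) in *; clearbody l
end.
assert (Hle : Rbar_le l B) by (apply Hl; intros x [t [Ht ->]]; apply HB, Ht).
assert (Hge : forall t, a <= t <= b -> Rbar_le (Rabs (f t - f a)) l).
{ intros t Ht; apply Hu; exists t; auto. }
pose proof (Hge a ltac:(lra)) as Ha.
destruct l as [M | |]; try contradiction; exists M; repeat split; trivial.
apply Rle_trans with (2 := Ha), Rabs_pos.
Qed.

Lemma Rbar_scal_nonneg (q : R) (X : Rbar) :
  0 <= q -> Rbar_le 0 X -> Rbar_le 0 (Rbar_mult q X).
Proof.
intros Hq HX; destruct X as [x | |]; try contradiction; simpl in *.
- apply Rmult_le_pos; assumption.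
- unfold Rbar_mult; simpl; destruct (Rle_dec 0 q); [| contradiction].
  destruct (Rle_lt_or_eq_dec 0 q); simpl; [trivial | lra].
Qed.

(** As $0\cdot\infty=0$, a finite product forces a finite factor only for [q > 0]; for [q = 0] the
    formula for [r] still holds. *)
Lemma Rbar_scal_finite (q r : R) (X : Rbar) :
  0 <= q -> Rbar_le 0 X -> Rbar_mult q X = Finite r ->
  r = q * real X /\ (0 < q -> X = Finite (real X)).
Proof.
intros Hq HX; destruct X as [x | |]; try contradiction.
- simpl; intros E; injection E as <-; auto.
- unfold Rbar_mult; simpl; destruct (Rle_dec 0 q); [| contradiction].
  destruct (Rle_lt_or_eq_dec 0 q) as [H | H]; intros E; [discriminate |].
  injection E as <-; subst q; split; [ring | lra].
Qed.

(** Partial sums lie below the supremum [s], so no non-negative term can be infinite. *)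
Lemma Rbar_series_finite (t : nat -> Rbar) (s : R) :
  (forall k, Rbar_le 0 (t k)) -> Rbar_series t = Finite s ->
  (forall k, t k = Finite (real (t k))) /\
  (forall n, sum_f_R0 (fun k => real (t k)) n <= s).
Proof.
intros Ht Hs.
assert (Hle : forall n, Rbar_le (Rbar_psum t n) s).
{ intros n; rewrite <- Hs; apply is_sup_seq_major, Sup_seq_correct. }
assert (fin : forall x, Rbar_le 0 x -> x <> p_infty -> x = Finite (real x)).
{ intros [x | |] H1 H2; [reflexivity | elim H2; reflexivity | contradiction]. }
assert (H : forall n, t n = Finite (real (t n)) /\
  Rbar_psum t n = Finite (sum_f_R0 (fun k => real (t k)) n)).
{ induction n as [| n [IH1 IH2]].
  - assert (t O = Finite (real (t O))).
    { apply fin; [apply Ht |]; intros E; pose proof (Hle O) as H; simpl in H.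
      rewrite E in H; exact H. }
    split; assumption.
  - assert (E : t (S n) = Finite (real (t (S n)))).
    { apply fin; [apply Ht |]; intros E; pose proof (Hle (S n)) as H; simpl in H.
      rewrite IH2, E in H; exact H. }
    split; [exact E |]; simpl Rbar_psum; rewrite IH2, E; reflexivity. }
split; [intros k; apply H |].
intros n; pose proof (Hle n) as B; rewrite (proj2 (H n)) in B; exact B.
Qed.

Lemma Rbar_series_nonneg (t : nat -> Rbar) :
  (forall k, Rbar_le 0 (t k)) -> Rbar_le 0 (Rbar_series t).
Proof. intros Ht; apply (Sup_seq_minor_le _ 0 O); apply Ht. Qed.

(** The signs exclude $\infty-\infty$, to which [Rbar_plus] assigns the finite value 0. *)
Lemma Rbar_plus_finite_nonneg (X Y : Rbar) (s : R) :
  Rbar_le 0 X -> Rbar_le 0 Y -> Rbar_plus X Y = Finite s ->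
  exists x y, X = Finite x /\ Y = Finite y /\ x + y = s.
Proof.
intros HX HY; destruct X as [x | |]; destruct Y as [y | |]; try contradiction;
  try discriminate.
intros E; injection E as <-; exists x, y; auto.
Qed.

(** * From the finiteness of $S$ to the integral and its bound *)

Theorem theorem1 (a b : R) (f g : R -> R) (eta theta : nat -> R) :
  a < b ->
  regulated f a b -> regulated g a b ->
  (forall x, a <= x <= b -> continuous_on_at f a b x \/ continuous_on_at g a b x) ->
  (forall k, 0 <= eta k) -> (forall k, eta (S k) <= eta k) -> is_lim_seq eta 0 ->
  (forall k, 0 <= theta k) -> (forall k, theta (S k) <= theta k) -> is_lim_seq theta 0 ->
  forall s : R, S_bound f g a b eta theta = Finite s ->
  exists I : R, is_RS_integral f g a b I /\
    Rabs (I - f a * (g b - g a)) <= s.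
Proof.
intros Hab Hf Hg Hcont eta0 eta_dec eta_lim theta0 theta_dec theta_lim s HS.
assert (Hab' : a <= b) by lra.
destruct (regulated_bounded a b f Hab' Hf) as [B HB].
destruct (osc_from_a_finite f a b B Hab' HB) as [M [EM [M0 HM]]].
destruct (regulated_bounded a b g Hab' Hg) as [N HN].
(* The shifted sequence $\eta_{k-1}$ with real values. *)
set (e := fun k => match k with O => M | S j => eta j end).
assert (Ee : forall k, eta_prev f a b eta k = Finite (e k)).
{ intros [| k]; [exact EM | reflexivity]. }
assert (e0 : forall k, 0 <= e k) by (intros [| k]; simpl; auto).
set (TVg := fun k => TVtrunc g a b (theta k)).
set (TVf := fun k => TVtrunc f a b (eta k)).
assert (TVg0 : forall k, Rbar_le 0 (TVg k)) by (intros k; apply TVtrunc_nonneg, Hab').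
assert (TVf0 : forall k, Rbar_le 0 (TVf k)) by (intros k; apply TVtrunc_nonneg, Hab').
assert (real0 : forall X, Rbar_le 0 X -> 0 <= real X).
{ intros [x | |] HX; simpl in *; lra. }
assert (pow0 : forall k, 0 < 2 ^ k) by (intros k; apply pow_lt; lra).
assert (t1_0 : forall k, Rbar_le 0 (Rbar_mult (Finite (2 ^ k))
                     (Rbar_mult (eta_prev f a b eta k) (TVg k)))).
{ intros k; rewrite Ee; apply Rbar_scal_nonneg; [left; apply pow0 |].
  apply Rbar_scal_nonneg; auto. }
assert (t2_pos : forall k, 0 <= 2 ^ k * theta k).
{ intros k; apply Rmult_le_pos; [left; apply pow0 | apply theta0]. }
assert (t2_0 : forall k, Rbar_le 0 (Rbar_mult (Finite (2 ^ k * theta k)) (TVf k))).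
{ intros k; apply Rbar_scal_nonneg; auto. }
destruct (Rbar_plus_finite_nonneg _ _ s (Rbar_series_nonneg _ t1_0)
            (Rbar_series_nonneg _ t2_0) HS) as [s1 [s2 [E1 [E2 Es]]]].
destruct (Rbar_series_finite _ s1 t1_0 E1) as [F1 S1].
destruct (Rbar_series_finite _ s2 t2_0 E2) as [F2 S2].
set (T := fun k => real (TVg k)); set (U := fun k => real (TVf k)).
assert (G1 : forall k, real (Rbar_mult (Finite (2 ^ k))
   (Rbar_mult (eta_prev f a b eta k) (TVg k))) = 2 ^ k * (e k * T k) /\
   (0 < e k -> TVg k = Finite (T k))).
{ intros k; pose proof (F1 k) as E; rewrite Ee in E |- *.
  destruct (Rbar_scal_finite _ _ _ (Rlt_le _ _ (pow0 k))
              (Rbar_scal_nonneg _ _ (e0 k) (TVg0 k)) E) as [A1 A2].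
  destruct (Rbar_scal_finite _ _ _ (e0 k) (TVg0 k) (A2 (pow0 k))) as [A3 A4].
  split; [rewrite A1, A3; reflexivity | exact A4]. }
assert (G2 : forall k, real (Rbar_mult (Finite (2 ^ k * theta k)) (TVf k)) =
   2 ^ k * theta k * U k /\ (0 < theta k -> TVf k = Finite (U k))).
{ intros k; destruct (Rbar_scal_finite _ _ _ (t2_pos k) (TVf0 k) (F2 k)) as [A1 A2].
  split; [exact A1 | intros tk; apply A2, Rmult_lt_0_compat; auto]. }
(* Both series are merged term by term, so that one sum of costs is bounded by [s]. *)
set (c := fun k => 2 ^ k * (e k * T k) + 2 ^ k * theta k * U k).
assert (HL : forall n, sum_f_R0 c n <= s).
{ intros n; unfold c; rewrite sum_plus, <- Es; apply Rplus_le_compat.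
  - rewrite <- (sum_eq _ _ n (fun k _ => proj1 (G1 k))); apply S1.
  - rewrite <- (sum_eq _ _ n (fun k _ => proj1 (G2 k))); apply S2. }
assert (T0 : forall k, 0 <= T k) by (intros k; apply real0, TVg0).
assert (U0 : forall k, 0 <= U k) by (intros k; apply real0, TVf0).
assert (Tapp' : forall k, 0 < e k -> forall ka, 0 < ka ->
  exists u, BV_near a b g u (theta k) (T k + ka)).
{ intros k ek ka Hka; apply TVtrunc_approx; trivial; apply G1, ek. }
assert (Uapp : forall k, 0 < theta k -> forall ka, 0 < ka ->
  exists v, BV_near a b f v (eta k) (U k + ka)).
{ intros k tk ka Hka; apply TVtrunc_approx; trivial; apply G2, tk. }
assert (real_mono : forall X Y y, Rbar_le 0 X -> Rbar_le X Y -> Y = Finite y -> real X <= y).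
{ intros [x | |] Y y HX HXY ->; simpl in *; [exact HXY | contradiction | contradiction]. }
(* Positivity of the coefficient makes the larger variation finite; otherwise [real] would send it
   to 0 and spoil the comparison. *)
assert (Tmono : forall k, 0 < eta k -> T k <= T (S k)).
{ intros k ek; apply (real_mono _ (TVg (S k))); [apply TVg0 | | apply (G1 (S k)), ek].
  apply TVtrunc_antitone, theta_dec. }
assert (Umono : forall k, 0 < theta (S k) -> U k <= U (S k)).
{ intros k tk; apply (real_mono _ (TVf (S k))); [apply TVf0 | | apply (G2 (S k)), tk].
  apply TVtrunc_antitone, eta_dec. }
assert (Tapp : forall k, 0 < eta k -> forall ka, 0 < ka ->
  exists u, BV_near a b g u (theta (S k)) (T (S k) + ka)) by (intros k; apply (Tapp' (S k))).
(* The weight $2^{k+1}\ge 2$ pays for the two variations in each replacement. *)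
assert (Hc : forall k, 2 * (eta k * T (S k)) + 2 * (theta (S k) * U (S k)) <= c (S k)).
{ intros k; unfold c; change (e (S k)) with (eta k).
  assert (2 <= 2 ^ S k) by (simpl; generalize (pow_R1_Rle 2 k); lra).
  rewrite Rmult_assoc; apply Rplus_le_compat; apply Rmult_le_compat_r; trivial;
    apply Rmult_le_pos; auto. }
assert (Hc0 : M * T O + theta O * U O <= c O) by (unfold c; simpl; lra).
assert (HN' : forall q r, a <= q <= b -> a <= r <= b -> Rabs (g r - g q) <= 2 * N).
{ intros q r Hq Hr; generalize (HN q Hq) (HN r Hr).
  unfold Rabs; repeat destruct Rcase_abs; lra. }
assert (bound : forall p nu l, tagged_partition a b p nu l -> Rabs (RS_dev a f g p nu l) <= s).
{ intros p nu l HP.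
  apply (chain_total a b f g eta theta T U c) with (M := M) (N := 2 * N); trivial.
  exact (Tapp' O). }
destruct (RS_integral_exists a b f g Hab Hcont) as [I HI].
{ intros eps He.
  (* Either all thresholds are positive and the chain supplies the approximations, or [f] or [g] has
     bounded variation and only the other function is approximated. *)
  destruct (chain_dichotomy a b f g eta theta T U) with (M := M)
    as [Hpos | [[w Hw] | [w Hw]]]; trivial.
  - exact (Tapp' O).
  - apply (BV_approx_chain a b f g eta theta T U c) with (L := s); trivial.
  - apply (BV_approx_of_controls_l a b eps f g w); trivial.
  - apply (BV_approx_of_controls_r a b eps f g w); trivial. }
exists I; split; [exact HI |].
apply RS_integral_bound; assumption.
Qed.
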